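(* Let $\mathbb{X}$ be a Cartesian difference category with tangent bundle monad $(\mathsf{T},\mu,\eta)$, and let $\mathbb{X}^{\mathsf{T}}_{lin}$ be the category of linear $\mathsf{T}$-algebras, i.e. the full subcategory of the Eilenberg–Moore category of $(\mathsf{T},\mu,\eta)$ on those $\mathsf{T}$-algebras $(A,\nu)$ for which the structure map $\nu:\mathsf{T}(A)\to A$ is linear. Then $\mathbb{X}^{\mathsf{T}}_{lin}$ is a Cartesian difference category such that the forgetful functor $\mathsf{U}:\mathbb{X}^{\mathsf{T}}_{lin}\to\mathbb{X}$, $\mathsf{U}(A,\nu)=A$, $\mathsf{U}(f)=f$, preserves the Cartesian difference structure strictly (that is, the finite products, sums and zero maps, infinitesimal extension and difference combinator of $\mathbb{X}^{\mathsf{T}}_{lin}$ are sent by $\mathsf{U}$ to those of $\mathbb{X}$).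
   Context: Composition is written $g\circ f$ (first $f$, then $g$). A Cartesian category is a category with chosen finite products: binary products $A\times B$ with projections $\pi_0:A\times B\to A$, $\pi_1:A\times B\to B$, pairing $\langle -,-\rangle$, $f\times g=\langle f\circ\pi_0,g\circ\pi_1\rangle$, and terminal object $\top$. A left additive category is a category in which each hom-set is a commutative monoid $(+,0)$ with $(f+g)\circ h=f\circ h+g\circ h$ and $0\circ f=0$. A map $k$ is additive if $k\circ(f+g)=k\circ f+k\circ g$ and $k\circ 0=0$. A Cartesian left additive category is a Cartesian category that is also left additive and whose projections are all additive. An infinitesimal extension $\varepsilon$ on a Cartesian left additive category $\mathbb{X}$ consists of functions $\varepsilon:\mathbb{X}(A,B)\to\mathbb{X}(A,B)$ for all $A,B$ such that [E.1] $\varepsilon(f+g)=\varepsilon(f)+\varepsilon(g)$, $\varepsilon(0)=0$; [E.2] $\varepsilon(g\circ f)=\varepsilon(g)\circ f$; [E.3] $\varepsilon(\pi_i)=\pi_i\circ\varepsilon(1_{A\times B})$ for $i=0,1$. A Cartesian difference category is a Cartesian left additive category with an infinitesimal extension $\varepsilon$ and a difference combinator $\boldsymbol\partial$, assigning to each $f:A\to B$ a map $\boldsymbol\partial[f]:A\times A\to B$, such that (for all suitable maps): [C∂.0] $f\circ(x+\varepsilon(y))=f\circ x+\varepsilon(\boldsymbol\partial[f]\circ\langle x,y\rangle)$; [C∂.1] $\boldsymbol\partial[f+g]=\boldsymbol\partial[f]+\boldsymbol\partial[g]$, $\boldsymbol\partial[0]=0$, $\boldsymbol\partial[\varepsilon(f)]=\varepsilon(\boldsymbol\partial[f])$;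 [C∂.2] $\boldsymbol\partial[f]\circ\langle x,y+z\rangle=\boldsymbol\partial[f]\circ\langle x,y\rangle+\boldsymbol\partial[f]\circ\langle x+\varepsilon(y),z\rangle$, $\boldsymbol\partial[f]\circ\langle x,0\rangle=0$; [C∂.3] $\boldsymbol\partial[1_A]=\pi_1$, $\boldsymbol\partial[\pi_0]=\pi_0\circ\pi_1$, $\boldsymbol\partial[\pi_1]=\pi_1\circ\pi_1$; [C∂.4] $\boldsymbol\partial[\langle f,g\rangle]=\langle\boldsymbol\partial[f],\boldsymbol\partial[g]\rangle$; [C∂.5] $\boldsymbol\partial[g\circ f]=\boldsymbol\partial[g]\circ\langle f\circ\pi_0,\boldsymbol\partial[f]\rangle$; [C∂.6] $\boldsymbol\partial[\boldsymbol\partial[f]]\circ\langle\langle x,y\rangle,\langle 0,z\rangle\rangle=\boldsymbol\partial[f]\circ\langle x+\varepsilon(y),z\rangle$; [C∂.7] $\boldsymbol\partial[\boldsymbol\partial[f]]\circ\langle\langle x,y\rangle,\langle z,0\rangle\rangle=\boldsymbol\partial[\boldsymbol\partial[f]]\circ\langle\langle x,z\rangle,\langle y,0\rangle\rangle$. A map $f:A\to B$ in a Cartesian difference category is linear if $\boldsymbol\partial[f]=f\circ\pi_1$. The tangent bundle monad $(\mathsf{T},\mu,\eta)$ is given by $\mathsf{T}(A)=A\times A$, $\mathsf{T}(f)=\langle f\circ\pi_0,\boldsymbol\partial[f]\rangle$, $\eta_A=\langle 1_A,0\rangle$, $\mu_A=\langle\pi_{00},\pi_{10}+\pi_{01}+\varepsilon(\pi_{11})\rangle$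 with $\pi_{ij}=\pi_i\circ\pi_j$. A $\mathsf{T}$-algebra is $(A,\nu:\mathsf{T}(A)\to A)$ with $\nu\circ\eta_A=1_A$ and $\nu\circ\mathsf{T}(\nu)=\nu\circ\mu_A$; a $\mathsf{T}$-algebra morphism $f:(A,\nu)\to(B,\omega)$ is a map $f:A\to B$ with $\omega\circ\mathsf{T}(f)=f\circ\nu$ (morphisms in $\mathbb{X}^{\mathsf{T}}_{lin}$ need not be linear). Let $\phi_{A,B}=\langle\mathsf{T}(\pi_0),\mathsf{T}(\pi_1)\rangle:\mathsf{T}(A\times B)\to\mathsf{T}(A)\times\mathsf{T}(B)$. Products of $\mathsf{T}$-algebras are $(A,\nu)\times(B,\omega)=(A\times B,(\nu\times\omega)\circ\phi_{A,B})$, with projections and pairing as in $\mathbb{X}$, and terminal object $(\top,0)$. The sums, zero maps, infinitesimal extension and difference combinator on $\mathbb{X}^{\mathsf{T}}_{lin}$ are those of $\mathbb{X}$. *)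

(* Defs.v *)
(* Equality of maps is Leibniz equality; proof irrelevance identifies maps of
   algebras with equal underlying maps. *)
From Stdlib Require Import ProofIrrelevance.

Set Implicit Arguments.
Unset Strict Implicit.
Unset Printing Implicit Defensive.

Declare Scope cat_scope.
Delimit Scope cat_scope with cat.
Local Open Scope cat_scope.

Reserved Notation "g ∘ f" (at level 40, left associativity).
Reserved Notation "A × B" (at level 40, left associativity).
Reserved Notation "⟨ f , g ⟩" (at level 0, f at level 99, g at level 99).

Record Category := {
  ob :> Type;
  hom : ob -> ob -> Type;
  idm : forall A, hom A A;
  comp : forall A B C, hom B C -> hom A B -> hom A C;
  comp_id_l : forall A B (f : hom A B), comp (idm B) f = f;
  comp_id_r : forall A B (f : hom A B), comp f (idm A) = f;
  comp_assoc : forall A B C D (h : hom C D) (g : hom B C) (f : hom A B),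
    comp h (comp g f) = comp (comp h g) f
}.
Arguments idm {c} A.
Notation "g ∘ f" := (comp g f) : cat_scope.

Record Functor (C D : Category) := {
  fob :> C -> D;
  fmap : forall A B, hom A B -> hom (fob A) (fob B);
  fmap_id : forall A, fmap (idm A) = idm (fob A);
  fmap_comp : forall A B E (g : hom B E) (f : hom A B),
    fmap (g ∘ f) = fmap g ∘ fmap f
}.
Arguments fmap {C D} F {A B} f : rename.

Definition comp_functor (C D E : Category) (G : Functor D E) (F : Functor C D) :
  Functor C E.
Proof.
refine {| fob := fun A => G (F A);
          fmap := fun A B f => fmap G (fmap F f) |}.
- intros A. now rewrite !fmap_id.
- intros A B K g f. now rewrite !fmap_comp.
Defined.

Record Monad (C : Category) := {
  mfun :> Functor C C;
  eta : forall A, hom A (mfun A);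
  mu : forall A, hom (mfun (mfun A)) (mfun A);
  eta_natural : forall A B (f : hom A B), fmap mfun f ∘ eta A = eta B ∘ f;
  mu_natural : forall A B (f : hom A B),
    fmap mfun f ∘ mu A = mu B ∘ fmap mfun (fmap mfun f);
  mu_eta : forall A, mu A ∘ eta (mfun A) = idm (mfun A);
  mu_fmap_eta : forall A, mu A ∘ fmap mfun (eta A) = idm (mfun A);
  mu_mu : forall A, mu A ∘ mu (mfun A) = mu A ∘ fmap mfun (mu A)
}.
Arguments eta {C} M A : rename.
Arguments mu {C} M A : rename.

Section EilenbergMoore.
Variables (C : Category) (M : Monad C).

Record Algebra := {
  carrier : C;
  action : hom (M carrier) carrier;
  action_eta : action ∘ eta M carrier = idm carrier;
  action_mu : action ∘ fmap M action = action ∘ mu M carrier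
}.

Definition is_algebra_map (a b : Algebra) (f : hom (carrier a) (carrier b)) :=
  action b ∘ fmap M f = f ∘ action a.

Definition algebra_hom (a b : Algebra) :=
  { f : hom (carrier a) (carrier b) | is_algebra_map f }.

Lemma algebra_hom_eq (a b : Algebra) (f g : algebra_hom a b) :
  proj1_sig f = proj1_sig g -> f = g.
Proof.
destruct f as [f pf], g as [g pg]; cbn; intros <-.
now rewrite (proof_irrelevance _ pf pg).
Qed.

Lemma id_algebra_map (a : Algebra) : @is_algebra_map a a (idm (carrier a)).
Proof.
unfold is_algebra_map. now rewrite fmap_id, comp_id_r, comp_id_l.
Qed.

Lemma comp_algebra_map (a b c : Algebra)
  (g : hom (carrier b) (carrier c)) (f : hom (carrier a) (carrier b)) :
  is_algebra_map g -> is_algebra_map f -> @is_algebra_map a c (g ∘ f).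
Proof.
unfold is_algebra_map. intros Hg Hf.
now rewrite fmap_comp, comp_assoc, Hg, <- !comp_assoc, Hf.
Qed.

Definition EM : Category.
Proof.
refine
  {| ob := Algebra;
     hom := algebra_hom;
     idm := fun a => exist _ (idm (carrier a)) (id_algebra_map a);
     comp := fun a b c g f =>
       exist _ (proj1_sig g ∘ proj1_sig f)
         (comp_algebra_map (proj2_sig g) (proj2_sig f)) |}.
- intros a b f. apply algebra_hom_eq, comp_id_l.
- intros a b f. apply algebra_hom_eq, comp_id_r.
- intros a b c d h g f. apply algebra_hom_eq, comp_assoc.
Defined.

Definition EM_forget : Functor EM C.
Proof.
refine {| fob := fun a : EM => carrier a : C;
          fmap := fun (a b : EM) (f : hom a b) => proj1_sig f |}.
- reflexivity.
- reflexivity.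
Defined.

(* The pair (A, ν) underlying an algebra, without the proofs of its laws. *)
Definition algebra_data (a : Algebra) : { A : C & hom (M A) A } :=
  existT (fun A => hom (M A) A) (carrier a) (action a).

End EilenbergMoore.
Arguments Algebra {C} M.

Definition full_subcategory (C : Category) (P : C -> Prop) : Category.
Proof.
refine {| ob := { A : C | P A };
          hom := fun A B => hom (proj1_sig A) (proj1_sig B);
          idm := fun A => idm (proj1_sig A);
          comp := fun A B E g f => g ∘ f |}.
- intros A B f. apply comp_id_l.
- intros A B f. apply comp_id_r.
- intros A B E F h g f. apply comp_assoc.
Defined.

Definition inclusion (C : Category) (P : C -> Prop) :
  Functor (full_subcategory P) C.
Proof.
refine {| fob := fun A : full_subcategory P => proj1_sig A;
          fmap := fun (A B : full_subcategory P) (f : hom A B) =>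
            f : hom (proj1_sig A) (proj1_sig B) |}.
- reflexivity.
- reflexivity.
Defined.

Class Cartesian (C : Category) := {
  cprod : C -> C -> C;
  proj0 : forall A B, hom (cprod A B) A;
  proj1 : forall A B, hom (cprod A B) B;
  pairing : forall Z A B, hom Z A -> hom Z B -> hom Z (cprod A B);
  proj0_pairing : forall Z A B (f : hom Z A) (g : hom Z B),
    proj0 A B ∘ pairing f g = f;
  proj1_pairing : forall Z A B (f : hom Z A) (g : hom Z B),
    proj1 A B ∘ pairing f g = g;
  pairing_unique : forall Z A B (f : hom Z A) (g : hom Z B)
    (h : hom Z (cprod A B)),
    proj0 A B ∘ h = f -> proj1 A B ∘ h = g -> h = pairing f g;
  terminal : C;
  bang : forall Z, hom Z terminal;
  bang_unique : forall Z (h : hom Z terminal), h = bang Z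
}.
Arguments terminal {C _}.
Notation "A × B" := (cprod A B) : cat_scope.
Notation "⟨ f , g ⟩" := (pairing f g) : cat_scope.
Notation "'π0'" := (proj0 _ _) : cat_scope.
Notation "'π1'" := (proj1 _ _) : cat_scope.
Notation "⊤" := terminal : cat_scope.

Definition prod_map (C : Category) {H : Cartesian C} (A B A' B' : C)
  (f : hom A A') (g : hom B B') : hom (A × B) (A' × B') :=
  ⟨f ∘ π0, g ∘ π1⟩.

Class LeftAdditive (C : Category) := {
  add : forall A B : C, hom A B -> hom A B -> hom A B;
  zero : forall A B : C, hom A B;
  add_assoc : forall (A B : C) (f g h : hom A B),
    add f (add g h) = add (add f g) h;
  add_comm : forall (A B : C) (f g : hom A B), add f g = add g f;
  add_zero_l : forall (A B : C) (f : hom A B), add (zero A B) f = f;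
  add_comp : forall (A B E : C) (f g : hom B E) (h : hom A B),
    add f g ∘ h = add (f ∘ h) (g ∘ h);
  zero_comp : forall (A B E : C) (f : hom A B),
    zero B E ∘ f = zero A E
}.
Notation "f + g" := (add f g) : cat_scope.
Notation "0" := (zero _ _) : cat_scope.

Definition is_additive (C : Category) {H : LeftAdditive C} (B E : C)
  (k : hom B E) : Prop :=
  (forall A (f g : hom A B), k ∘ (f + g) = k ∘ f + k ∘ g) /\
  (forall A, k ∘ (0 : hom A B) = 0).

Class CartesianLeftAdditive (C : Category) := {
  cla_cartesian :: Cartesian C;
  cla_additive :: LeftAdditive C;
  proj0_additive : forall A B : C, is_additive (proj0 A B);
  proj1_additive : forall A B : C, is_additive (proj1 A B)
}.

Class InfinitesimalExtension (C : Category) (H : CartesianLeftAdditive C) := {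
  eps : forall A B : C, hom A B -> hom A B;
  eps_add : forall (A B : C) (f g : hom A B), eps (f + g) = eps f + eps g;
  eps_zero : forall A B : C, eps (0 : hom A B) = 0;
  eps_comp : forall (A B E : C) (g : hom B E) (f : hom A B),
    eps (g ∘ f) = eps g ∘ f;
  eps_proj0 : forall A B : C, eps (proj0 A B) = π0 ∘ eps (idm (A × B));
  eps_proj1 : forall A B : C, eps (proj1 A B) = π1 ∘ eps (idm (A × B))
}.
Notation ε := eps.

Class CartesianDifference (C : Category) := {
  cd_cla :: CartesianLeftAdditive C;
  cd_eps :: InfinitesimalExtension cd_cla;
  diff : forall A B : C, hom A B -> hom (A × A) B;
  diff_eps : forall (Z A B : C) (f : hom A B) (x y : hom Z A),
    f ∘ (x + ε y) = f ∘ x + ε (diff f ∘ ⟨x, y⟩);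
  diff_add : forall (A B : C) (f g : hom A B), diff (f + g) = diff f + diff g;
  diff_zero : forall A B : C, diff (0 : hom A B) = 0;
  diff_of_eps : forall (A B : C) (f : hom A B), diff (ε f) = ε (diff f);
  diff_add_r : forall (Z A B : C) (f : hom A B) (x y z : hom Z A),
    diff f ∘ ⟨x, y + z⟩ = diff f ∘ ⟨x, y⟩ + diff f ∘ ⟨x + ε y, z⟩;
  diff_zero_r : forall (Z A B : C) (f : hom A B) (x : hom Z A),
    diff f ∘ ⟨x, 0⟩ = 0;
  diff_id : forall A : C, diff (idm A) = π1;
  diff_proj0 : forall A B : C, diff (proj0 A B) = π0 ∘ π1;
  diff_proj1 : forall A B : C, diff (proj1 A B) = π1 ∘ π1;
  diff_pairing : forall (Z A B : C) (f : hom Z A) (g : hom Z B),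
    diff ⟨f, g⟩ = ⟨diff f, diff g⟩;
  diff_comp : forall (A B E : C) (g : hom B E) (f : hom A B),
    diff (g ∘ f) = diff g ∘ ⟨f ∘ π0, diff f⟩;
  diff_diff_linear : forall (Z A B : C) (f : hom A B) (x y z : hom Z A),
    diff (diff f) ∘ ⟨⟨x, y⟩, ⟨0, z⟩⟩ = diff f ∘ ⟨x + ε y, z⟩;
  diff_diff_sym : forall (Z A B : C) (f : hom A B) (x y z : hom Z A),
    diff (diff f) ∘ ⟨⟨x, y⟩, ⟨z, 0⟩⟩ = diff (diff f) ∘ ⟨⟨x, z⟩, ⟨y, 0⟩⟩
}.
Notation "∂[ f ]" := (diff f) (at level 0, f at level 99) : cat_scope.

Definition is_linear (C : Category) {H : CartesianDifference C} (A B : C)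
  (f : hom A B) : Prop := ∂[f] = f ∘ π1.

(* Maps are compared along the equalities of objects F (A × B) = F A × F B and
   F ⊤ = ⊤, by transporting their domain or codomain. *)
Definition cast_dom (C : Category) (A A' B : C) (e : A = A') (f : hom A' B) :
  hom A B := eq_rect_r (fun Z => hom Z B) f e.
Definition cast_cod (C : Category) (A B B' : C) (e : B = B') (f : hom A B') :
  hom A B := eq_rect_r (fun Z => hom A Z) f e.

Record strictly_preserves (C D : Category)
  {HC : CartesianDifference C} {HD : CartesianDifference D}
  (F : Functor C D) : Prop := {
  preserves_prod : forall A B, F (A × B) = F A × F B;
  preserves_proj0 : forall A B,
    fmap F (proj0 A B) = cast_dom (preserves_prod A B) π0;
  preserves_proj1 : forall A B,
    fmap F (proj1 A B) = cast_dom (preserves_prod A B) π1;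
  preserves_pairing : forall Z A B (f : hom Z A) (g : hom Z B),
    fmap F ⟨f, g⟩ = cast_cod (preserves_prod A B) ⟨fmap F f, fmap F g⟩;
  preserves_terminal : F ⊤ = ⊤;
  preserves_bang : forall Z,
    fmap F (bang Z) = cast_cod preserves_terminal (bang (F Z));
  preserves_add : forall A B (f g : hom A B),
    fmap F (f + g) = fmap F f + fmap F g;
  preserves_zero : forall A B, fmap F (0 : hom A B) = 0;
  preserves_eps : forall A B (f : hom A B), fmap F (ε f) = ε (fmap F f);
  preserves_diff : forall A B (f : hom A B),
    fmap F ∂[f] = cast_dom (preserves_prod A A) ∂[fmap F f]
}.

Section Tangent.
Context (X : Category) {H : CartesianDifference X}.

Lemma pairing_comp (Y Z A B : X) (f : hom Z A) (g : hom Z B) (h : hom Y Z) :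
  ⟨f, g⟩ ∘ h = ⟨f ∘ h, g ∘ h⟩.
Proof.
apply pairing_unique; now rewrite comp_assoc, ?proj0_pairing, ?proj1_pairing.
Qed.

Lemma pairing_eta (Z A B : X) (h : hom Z (A × B)) : ⟨π0 ∘ h, π1 ∘ h⟩ = h.
Proof. symmetry; now apply pairing_unique. Qed.

Lemma pairing_proj (A B : X) : ⟨π0, π1⟩ = idm (A × B).
Proof. symmetry; apply pairing_unique; apply comp_id_r. Qed.

Lemma add_zero_r (A B : X) (f : hom A B) : f + 0 = f.
Proof. now rewrite add_comm, add_zero_l. Qed.

Lemma add_left_comm (A B : X) (f g h : hom A B) : f + (g + h) = g + (f + h).
Proof. now rewrite !add_assoc, (add_comm f g). Qed.

Lemma proj0_add (Z A B : X) (f g : hom Z (A × B)) : π0 ∘ (f + g) = π0 ∘ f + π0 ∘ g.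
Proof. apply proj0_additive. Qed.
Lemma proj1_add (Z A B : X) (f g : hom Z (A × B)) : π1 ∘ (f + g) = π1 ∘ f + π1 ∘ g.
Proof. apply proj1_additive. Qed.
Lemma proj0_zero (Z A B : X) : proj0 A B ∘ (0 : hom Z _) = 0.
Proof. apply proj0_additive. Qed.
Lemma proj1_zero (Z A B : X) : proj1 A B ∘ (0 : hom Z _) = 0.
Proof. apply proj1_additive. Qed.

Lemma proj0_eps (Z A B : X) (f : hom Z (A × B)) : π0 ∘ ε f = ε (π0 ∘ f).
Proof.
now rewrite eps_comp, eps_proj0, <- comp_assoc, <- eps_comp, comp_id_l.
Qed.
Lemma proj1_eps (Z A B : X) (f : hom Z (A × B)) : π1 ∘ ε f = ε (π1 ∘ f).
Proof.
now rewrite eps_comp, eps_proj1, <- comp_assoc, <- eps_comp, comp_id_l.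
Qed.

Lemma pairing_ext (Z A B : X) (f g : hom Z (A × B)) :
  π0 ∘ f = π0 ∘ g -> π1 ∘ f = π1 ∘ g -> f = g.
Proof.
intros H0 H1. rewrite <- (pairing_eta f), <- (pairing_eta g). now rewrite H0, H1.
Qed.

Lemma pairing_add_eps (Z A B : X) (x z : hom Z A) (y w : hom Z B) :
  ⟨x, y⟩ + ε ⟨z, w⟩ = ⟨x + ε z, y + ε w⟩.
Proof.
apply pairing_ext;
  rewrite ?proj0_add, ?proj1_add, ?proj0_eps, ?proj1_eps,
    ?proj0_pairing, ?proj1_pairing; reflexivity.
Qed.

Lemma diff_comp_proj0 (A B E : X) (f : hom A (B × E)) : ∂[π0 ∘ f] = π0 ∘ ∂[f].
Proof.
now rewrite diff_comp, diff_proj0, <- comp_assoc, proj1_pairing.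
Qed.
Lemma diff_comp_proj1 (A B E : X) (f : hom A (B × E)) : ∂[π1 ∘ f] = π1 ∘ ∂[f].
Proof.
now rewrite diff_comp, diff_proj1, <- comp_assoc, proj1_pairing.
Qed.

Definition tangent_functor : Functor X X.
Proof.
refine {| fob := fun A => A × A;
          fmap := fun A B f => ⟨f ∘ π0, ∂[f]⟩ |}.
- intros A. now rewrite comp_id_l, diff_id, pairing_proj.
- intros A B E g f.
  now rewrite pairing_comp, <- !comp_assoc, proj0_pairing, diff_comp.
Defined.

Definition tangent_eta (A : X) : hom A (A × A) := ⟨idm A, 0⟩.

Definition tangent_mu (A : X) : hom ((A × A) × (A × A)) (A × A) :=
  ⟨π0 ∘ π0, π1 ∘ π0 + π0 ∘ π1 + ε (π1 ∘ π1)⟩.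

Lemma tangent_mu_pairing (Z A : X) (x y z w : hom Z A) :
  tangent_mu A ∘ ⟨⟨x, y⟩, ⟨z, w⟩⟩ = ⟨x, y + z + ε w⟩.
Proof.
unfold tangent_mu.
now rewrite pairing_comp, !add_comp, <- eps_comp, <- !comp_assoc,
  !proj0_pairing, !proj1_pairing, ?proj0_pairing, ?proj1_pairing.
Qed.

Lemma tangent_mu_linear (A : X) : is_linear (tangent_mu A).
Proof.
unfold is_linear, tangent_mu.
now rewrite diff_pairing, !diff_add, diff_of_eps,
  !diff_comp_proj0, !diff_comp_proj1, !diff_proj0, !diff_proj1,
  pairing_comp, !add_comp, !comp_assoc, <- eps_comp.
Qed.

Lemma tangent_eta_natural (A B : X) (f : hom A B) :
  fmap tangent_functor f ∘ tangent_eta A = tangent_eta B ∘ f.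
Proof.
cbn; unfold tangent_eta.
now rewrite !pairing_comp, diff_zero_r, zero_comp, <- comp_assoc,
  proj0_pairing, comp_id_l, comp_id_r.
Qed.

Lemma tangent_mu_natural (A B : X) (f : hom A B) :
  fmap tangent_functor f ∘ tangent_mu A =
  tangent_mu B ∘ fmap tangent_functor (fmap tangent_functor f).
Proof.
cbn. rewrite !pairing_comp, diff_pairing, tangent_mu_pairing.
rewrite diff_comp, diff_proj0.
unfold tangent_mu.
rewrite <- !comp_assoc, proj0_pairing.
f_equal.
rewrite (add_comm (π1 ∘ π0)), <- add_assoc, diff_add_r, <- pairing_add_eps,
  diff_eps, !pairing_eta, pairing_proj, comp_id_r.
now rewrite add_assoc, (add_comm (∂[f] ∘ _) (∂[f] ∘ _)).
Qed.

Lemma tangent_mu_eta (A : X) : tangent_mu A ∘ tangent_eta (A × A) = idm (A × A).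
Proof.
unfold tangent_eta.
rewrite <- (pairing_proj A A).
replace (zero (A × A) (A × A)) with (⟨0, 0⟩ : hom (A × A) (A × A)).
- now rewrite tangent_mu_pairing, eps_zero, !add_zero_r.
- symmetry. apply pairing_unique; [apply proj0_zero | apply proj1_zero].
Qed.

Lemma tangent_mu_fmap_eta (A : X) :
  tangent_mu A ∘ fmap tangent_functor (tangent_eta A) = idm (A × A).
Proof.
cbn; unfold tangent_eta.
now rewrite pairing_comp, diff_pairing, diff_id, diff_zero, zero_comp, comp_id_l,
  tangent_mu_pairing, eps_zero, add_zero_l, add_zero_r, pairing_proj.
Qed.

Lemma tangent_mu_mu (A : X) :
  tangent_mu A ∘ tangent_mu (A × A) =
  tangent_mu A ∘ fmap tangent_functor (tangent_mu A).
Proof.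
cbn. rewrite (tangent_mu_linear A : ∂[_] = _).
unfold tangent_mu.
rewrite !pairing_comp, !add_comp, <- !eps_comp, <- !comp_assoc.
repeat (rewrite ?proj0_pairing, ?proj1_pairing, ?proj0_add, ?proj1_add,
  ?proj0_eps, ?proj1_eps, ?eps_add, ?comp_assoc; rewrite <- ?comp_assoc).
f_equal.
rewrite <- !add_assoc. do 2 f_equal.
rewrite (add_left_comm _ (π0 ∘ (π0 ∘ π1))). f_equal.
now rewrite (add_left_comm _ (ε (π0 ∘ (π1 ∘ π1))) (ε (ε _))),
  (add_left_comm _ (ε (π0 ∘ (π1 ∘ π1)))).
Qed.

Definition tangent_monad : Monad X :=
  {| mfun := tangent_functor;
     eta := tangent_eta;
     mu := tangent_mu;
     eta_natural := tangent_eta_natural;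
     mu_natural := tangent_mu_natural;
     mu_eta := tangent_mu_eta;
     mu_fmap_eta := tangent_mu_fmap_eta;
     mu_mu := tangent_mu_mu |}.

(* Only the structure maps are required to be linear: the maps are all the
   algebra maps. *)
Definition LinAlg : Category :=
  full_subcategory (fun a : EM tangent_monad => is_linear (action a)).

Definition LinAlg_forget : Functor LinAlg X :=
  comp_functor (EM_forget tangent_monad) (inclusion _).

Definition tangent_phi (A B : X) :
  hom (tangent_monad (A × B)) (tangent_monad A × tangent_monad B) :=
  ⟨fmap tangent_monad π0, fmap tangent_monad π1⟩.

Definition prod_algebra_data (a b : Algebra tangent_monad) :
  { A : X & hom (tangent_monad A) A } :=
  existT (fun A => hom (tangent_monad A) A) (carrier a × carrier b)
    (prod_map (action a) (action b) ∘ tangent_phi (carrier a) (carrier b)).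

Definition terminal_algebra_data : { A : X & hom (tangent_monad A) A } :=
  existT (fun A => hom (tangent_monad A) A) ⊤ 0.

End Tangent.
Arguments tangent_monad X {H}.
Arguments LinAlg X {H}.
Arguments LinAlg_forget X {H}.
Arguments terminal_algebra_data X {H}.

(* Main.v *)
(** The only point that is not formal is that the difference combinator restricts
    to algebra maps. If f : (A, ν) -> (B, ω) is one, then differentiating
    f ∘ ν = ω ∘ T(f) and using linearity of ν and ω gives
    ∂[f]⟨ν⟨x,y⟩, ν⟨z,w⟩⟩ = ω⟨∂[f]⟨x,z⟩, ∂[∂[f]]⟨⟨x,y⟩,⟨z,w⟩⟩⟩.
    This is the algebra map condition for ∂[f] with y and z exchanged, and
    ∂[∂[f]]⟨⟨x,y⟩,⟨z,w⟩⟩ = ∂[∂[f]]⟨⟨x,y⟩,⟨z,0⟩⟩ + ∂[f]⟨x + ε(y) + ε(z), w⟩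
    is symmetric in y and z by [C∂.7]. *)
Require Import Defs.
Local Open Scope cat_scope.

Section LinearAlgebras.
Set Implicit Arguments.
Unset Strict Implicit.
Context (X : Category) {H : CartesianDifference X}.

Notation T := (tangent_monad X).

(** * Componentwise operations on pairs, and calculus of linear maps *)

Lemma pairing_add (Z A B : X) (x z : hom Z A) (y w : hom Z B) :
  ⟨x, y⟩ + ⟨z, w⟩ = ⟨x + z, y + w⟩.
Proof.
  apply pairing_unique; now rewrite ?proj0_add, ?proj1_add, ?proj0_pairing, ?proj1_pairing.
Qed.

Lemma pairing_zero (Z A B : X) : (0 : hom Z (A × B)) = ⟨0, 0⟩.
Proof. apply pairing_unique; [apply proj0_zero | apply proj1_zero]. Qed.

Lemma pairing_eps (Z A B : X) (x : hom Z A) (y : hom Z B) :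
  ε ⟨x, y⟩ = ⟨ε x, ε y⟩.
Proof.
  apply pairing_unique; now rewrite ?proj0_eps, ?proj1_eps, ?proj0_pairing, ?proj1_pairing.
Qed.

Lemma linear_diff (Z A B : X) (k : hom A B) (x y : hom Z A) :
  is_linear k -> ∂[k] ∘ ⟨x, y⟩ = k ∘ y.
Proof. intros Hk. now rewrite Hk, <- comp_assoc, proj1_pairing. Qed.

(** Since [k ∘ y] is [∂[k] ∘ ⟨0, y⟩], this is [C∂.2]: the base point shifted by [ε x] is harmless
    because [∂[k]] depends only on its second argument. *)
Lemma linear_add (Z A B : X) (k : hom A B) (x y : hom Z A) :
  is_linear k -> k ∘ (x + y) = k ∘ x + k ∘ y.
Proof.
  intros Hk. rewrite <- (linear_diff 0 (x + y) Hk), diff_add_r.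
  now rewrite !linear_diff.
Qed.

Lemma linear_zero (Z A B : X) (k : hom A B) :
  is_linear k -> k ∘ (0 : hom Z A) = 0.
Proof. intros Hk. now rewrite <- (linear_diff 0 0 Hk), diff_zero_r. Qed.

(** This is [C∂.0] at the base point [0]. *)
Lemma linear_eps (Z A B : X) (k : hom A B) (x : hom Z A) :
  is_linear k -> k ∘ ε x = ε (k ∘ x).
Proof.
  intros Hk. rewrite <- (add_zero_l (ε x)), diff_eps, linear_diff by exact Hk.
  now rewrite linear_zero, add_zero_l.
Qed.

Lemma linear_comp (A B E : X) (g : hom B E) (f : hom A B) :
  is_linear g -> is_linear f -> is_linear (g ∘ f).
Proof.
  unfold is_linear at 3. intros Hg Hf.
  now rewrite diff_comp, linear_diff, Hf, comp_assoc.
Qed.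

Lemma linear_pairing (Z A B : X) (f : hom Z A) (g : hom Z B) :
  is_linear f -> is_linear g -> is_linear ⟨f, g⟩.
Proof.
  unfold is_linear. intros Hf Hg. now rewrite diff_pairing, Hf, Hg, pairing_comp.
Qed.

Lemma linear_proj0 (A B : X) : is_linear (proj0 A B).
Proof. apply diff_proj0. Qed.

Lemma linear_proj1 (A B : X) : is_linear (proj1 A B).
Proof. apply diff_proj1. Qed.

Lemma linear_tangent (A B : X) (f : hom A B) :
  is_linear f -> is_linear (fmap T f).
Proof.
  intros Hf. cbn. rewrite (Hf : ∂[f] = _).
  apply linear_pairing; apply linear_comp; auto using linear_proj0, linear_proj1.
Qed.

(** * Symmetry of the second derivative *)

Lemma diff_diff_expand (Z A B : X) (f : hom A B) (x y z w : hom Z A) :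
  ∂[∂[f]] ∘ ⟨⟨x, y⟩, ⟨z, w⟩⟩ =
  ∂[∂[f]] ∘ ⟨⟨x, y⟩, ⟨z, 0⟩⟩ + ∂[f] ∘ ⟨x + (ε y + ε z), w⟩.
Proof.
  (* With this splitting, [C∂.2] for [∂[f]] moves the base point of the second summand to
     [⟨x + ε z, y⟩], where [C∂.6] collapses the second derivative. *)
  replace ⟨z, w⟩ with (⟨z, 0⟩ + ⟨0, w⟩)
    by now rewrite pairing_add, add_zero_l, add_zero_r.
  rewrite diff_add_r, pairing_add_eps, diff_diff_linear, eps_zero, add_zero_r.
  now rewrite <- add_assoc, (add_comm (ε z)).
Qed.

(** [C∂.7] gives only the case [w = 0]; the algebra map condition for [∂[f]] needs an arbitrary
    [w]. *)
Lemma diff_diff_flip (Z A B : X) (f : hom A B) (x y z w : hom Z A) :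
  ∂[∂[f]] ∘ ⟨⟨x, y⟩, ⟨z, w⟩⟩ = ∂[∂[f]] ∘ ⟨⟨x, z⟩, ⟨y, w⟩⟩.
Proof.
  rewrite (diff_diff_expand f x y), (diff_diff_expand f x z).
  now rewrite diff_diff_sym, (add_comm (ε y)).
Qed.

(** * Product and terminal linear algebras *)

Definition prod_action (a b : Algebra T) :
  hom (T (carrier a × carrier b)) (carrier a × carrier b) :=
  prod_map (action a) (action b) ∘ tangent_phi (carrier a) (carrier b).

(** Read from right to left, this makes [π0] an algebra map. Together with [pairing_ext] and its
    companion for [π1], it reduces the laws of the product algebra to those of the factors. *)
Lemma proj0_prod_action (a b : Algebra T) :
  π0 ∘ prod_action a b = action a ∘ fmap T π0.
Proof.
  unfold prod_action, prod_map, tangent_phi.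
  now rewrite comp_assoc, proj0_pairing, <- comp_assoc, proj0_pairing.
Qed.

Lemma proj1_prod_action (a b : Algebra T) :
  π1 ∘ prod_action a b = action b ∘ fmap T π1.
Proof.
  unfold prod_action, prod_map, tangent_phi.
  now rewrite comp_assoc, proj1_pairing, <- comp_assoc, proj1_pairing.
Qed.

Lemma prod_action_eta (a b : Algebra T) :
  prod_action a b ∘ eta T _ = idm _.
Proof.
  apply pairing_ext.
  - now rewrite comp_assoc, proj0_prod_action, <- comp_assoc, eta_natural,
      comp_assoc, action_eta, comp_id_l, comp_id_r.
  - now rewrite comp_assoc, proj1_prod_action, <- comp_assoc, eta_natural,
      comp_assoc, action_eta, comp_id_l, comp_id_r.
Qed.

(** On each factor: functoriality of [T], the law [action_mu] of that factor, and naturality of [mu]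
    at the projection. *)
Lemma prod_action_mu (a b : Algebra T) :
  prod_action a b ∘ fmap T (prod_action a b) = prod_action a b ∘ mu T _.
Proof.
  apply pairing_ext.
  - now rewrite !comp_assoc, proj0_prod_action, <- !comp_assoc, <- fmap_comp,
      proj0_prod_action, fmap_comp, comp_assoc, action_mu, <- comp_assoc,
      <- mu_natural.
  - now rewrite !comp_assoc, proj1_prod_action, <- !comp_assoc, <- fmap_comp,
      proj1_prod_action, fmap_comp, comp_assoc, action_mu, <- comp_assoc,
      <- mu_natural.
Qed.

Definition prod_algebra (a b : Algebra T) : Algebra T :=
  {| action_eta := prod_action_eta a b; action_mu := prod_action_mu a b |}.

(** The action is built from linear maps by composition, pairing and [T], each of which preserves
    linearity. *)
Lemma linear_prod_algebra (a b : Algebra T) :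
  is_linear (action a) -> is_linear (action b) ->
  is_linear (action (prod_algebra a b)).
Proof.
  intros Ha Hb. unfold prod_algebra, prod_action, prod_map, tangent_phi; simpl action.
  apply linear_comp; apply linear_pairing;
    try apply linear_tangent; try apply linear_comp;
    auto using linear_proj0, linear_proj1.
Qed.

Lemma terminal_ext (Z : X) (f g : hom Z ⊤) : f = g.
Proof. now rewrite (bang_unique f), (bang_unique g). Qed.

Definition terminal_algebra : Algebra T :=
  {| carrier := ⊤; action := 0;
     action_eta := terminal_ext _ _; action_mu := terminal_ext _ _ |}.

Lemma linear_terminal_algebra : is_linear (action terminal_algebra).
Proof. apply terminal_ext. Qed.

(** * Closure of algebra maps under the operations of [X] *)

Lemma pairing_algebra_map (c a b : Algebra T)
  (f : hom (carrier c) (carrier a)) (g : hom (carrier c) (carrier b)) :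
  is_algebra_map f -> is_algebra_map g ->
  is_algebra_map (b := prod_algebra a b) ⟨f, g⟩.
Proof.
  unfold is_algebra_map. intros Hf Hg.
  change (prod_action a b ∘ fmap T ⟨f, g⟩ = ⟨f, g⟩ ∘ action c).
  rewrite pairing_comp. apply pairing_unique.
  - now rewrite comp_assoc, proj0_prod_action, <- comp_assoc, <- fmap_comp,
      proj0_pairing.
  - now rewrite comp_assoc, proj1_prod_action, <- comp_assoc, <- fmap_comp,
      proj1_pairing.
Qed.

(** [T] preserves sums because [∂] does, and the linear action of [b] distributes over the result.
    The zero map and [ε] follow the same pattern. *)
Lemma add_algebra_map (a b : Algebra T) (f g : hom (carrier a) (carrier b)) :
  is_linear (action b) -> is_algebra_map f -> is_algebra_map g ->
  is_algebra_map (f + g).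
Proof.
  unfold is_algebra_map. cbn. intros Hb Hf Hg.
  now rewrite !add_comp, diff_add, <- pairing_add, linear_add, Hf, Hg.
Qed.

Lemma zero_algebra_map (a b : Algebra T) :
  is_linear (action b) -> is_algebra_map (0 : hom (carrier a) (carrier b)).
Proof.
  unfold is_algebra_map. cbn. intros Hb.
  now rewrite !zero_comp, diff_zero, <- pairing_zero, linear_zero.
Qed.

Lemma eps_algebra_map (a b : Algebra T) (f : hom (carrier a) (carrier b)) :
  is_linear (action b) -> is_algebra_map f -> is_algebra_map (ε f).
Proof.
  unfold is_algebra_map. cbn. intros Hb Hf.
  now rewrite <- !eps_comp, diff_of_eps, <- pairing_eps, linear_eps, Hf.
Qed.

Lemma diff_algebra_map_pointwise (a b : Algebra T)
  (f : hom (carrier a) (carrier b)) (Z : X) (x y z w : hom Z (carrier a)) :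
  is_linear (action a) -> is_linear (action b) -> is_algebra_map f ->
  ∂[f] ∘ ⟨action a ∘ ⟨x, y⟩, action a ∘ ⟨z, w⟩⟩ =
  action b ∘ ⟨∂[f] ∘ ⟨x, z⟩, ∂[∂[f]] ∘ ⟨⟨x, y⟩, ⟨z, w⟩⟩⟩.
Proof.
  unfold is_algebra_map. cbn. intros Ha Hb Hf.
  (* Differentiate the algebra map equation and evaluate it at a generalised point; the chain rule
     and linearity of both actions then simplify the two sides. *)
  apply (f_equal (fun k => ∂[k] ∘ ⟨⟨x, y⟩, ⟨z, w⟩⟩)) in Hf.
  rewrite !diff_comp, diff_pairing, diff_comp, diff_proj0,
    (Ha : ∂[_] = _), <- !comp_assoc, !pairing_comp, linear_diff in Hf by exact Hb.
  rewrite <- !comp_assoc, !proj0_pairing, !proj1_pairing in Hf.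
  rewrite !pairing_comp, <- !comp_assoc, !proj0_pairing, !proj1_pairing,
    !proj0_pairing in Hf.
  now symmetry.
Qed.

Lemma diff_algebra_map (a b : Algebra T) (f : hom (carrier a) (carrier b)) :
  is_linear (action a) -> is_linear (action b) -> is_algebra_map f ->
  is_algebra_map (a := prod_algebra a a) ∂[f].
Proof.
  intros Ha Hb Hf.
  unfold is_algebra_map. simpl action.
  rewrite <- (pairing_eta (prod_action a a)), proj0_prod_action, proj1_prod_action.
  cbn. rewrite diff_proj0, diff_proj1.
  (* Here [x, y, z, w] are [π0 ∘ π0], [π0 ∘ π1], [π1 ∘ π0], [π1 ∘ π1]. Once [y] and [z] are
     exchanged, the nested pairing is the identity. *)
  rewrite (diff_algebra_map_pointwise _ _ _ _ Ha Hb Hf), diff_diff_flip.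
  now rewrite !pairing_eta, pairing_proj, comp_id_r.
Qed.

(** * The Cartesian difference structure on linear algebras *)

Lemma LinAlg_hom_eq (L M : LinAlg X) (f g : hom L M) :
  proj1_sig f = proj1_sig g -> f = g.
Proof. apply algebra_hom_eq. Qed.

Definition LinAlg_prod (L M : LinAlg X) : LinAlg X :=
  exist _ (prod_algebra (proj1_sig L) (proj1_sig M))
    (linear_prod_algebra (proj2_sig L) (proj2_sig M)).

Definition LinAlg_terminal : LinAlg X :=
  exist _ terminal_algebra linear_terminal_algebra.

(** As in the instances that follow, [LinAlg_hom_eq] reduces each axiom to an equation of underlying
    maps in [X]. They are all transparent so that the forgetful functor computes on them. *)
Definition LinAlg_cartesian : Cartesian (LinAlg X).
Proof.
  refine
    {| cprod := LinAlg_prod;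
       proj0 := fun L M => exist _ π0 (eq_sym (proj0_prod_action _ _)) : hom (LinAlg_prod L M) L;
       proj1 := fun L M => exist _ π1 (eq_sym (proj1_prod_action _ _)) : hom (LinAlg_prod L M) M;
       pairing := fun Z L M f g =>
         exist _ ⟨proj1_sig f, proj1_sig g⟩
           (pairing_algebra_map (proj2_sig f) (proj2_sig g)) : hom Z (LinAlg_prod L M);
       terminal := LinAlg_terminal;
       bang := fun Z => exist _ (bang _) (terminal_ext _ _) : hom Z LinAlg_terminal |}.
  - intros. apply LinAlg_hom_eq, proj0_pairing.
  - intros. apply LinAlg_hom_eq, proj1_pairing.
  - intros Z L M f g h <- <-. apply LinAlg_hom_eq. symmetry. apply pairing_eta.
  - intros. apply LinAlg_hom_eq, bang_unique.
Defined.

Definition LinAlg_left_additive : LeftAdditive (LinAlg X).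
Proof.
  refine
    {| add := fun (L M : LinAlg X) (f g : hom L M) =>
         exist _ (proj1_sig f + proj1_sig g)
           (add_algebra_map (proj2_sig M) (proj2_sig f) (proj2_sig g)) : hom L M;
       zero := fun L M =>
         exist _ 0 (zero_algebra_map (proj1_sig L) (proj2_sig M)) : hom L M |};
    intros; apply LinAlg_hom_eq.
  - apply add_assoc.
  - apply add_comm.
  - apply add_zero_l.
  - apply add_comp.
  - apply zero_comp.
Defined.

Definition LinAlg_cla : CartesianLeftAdditive (LinAlg X).
Proof.
  refine {| cla_cartesian := LinAlg_cartesian;
            cla_additive := LinAlg_left_additive |};
    intros L M; split; intros; apply LinAlg_hom_eq.
  - apply proj0_add.
  - apply proj0_zero.
  - apply proj1_add.
  - apply proj1_zero.
Defined.

Definition LinAlg_eps : InfinitesimalExtension LinAlg_cla.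
Proof.
  refine
    {| eps := fun (L M : LinAlg X) (f : hom L M) =>
         exist _ (ε (proj1_sig f))
           (eps_algebra_map (proj2_sig M) (proj2_sig f)) : hom L M |};
    intros; apply LinAlg_hom_eq.
  - apply eps_add.
  - apply eps_zero.
  - apply eps_comp.
  - apply eps_proj0.
  - apply eps_proj1.
Defined.

Definition LinAlg_difference : CartesianDifference (LinAlg X).
Proof.
  refine
    {| cd_cla := LinAlg_cla;
       cd_eps := LinAlg_eps;
       diff := fun (L M : LinAlg X) (f : hom L M) =>
         exist _ ∂[proj1_sig f]
           (diff_algebra_map (proj2_sig L) (proj2_sig M) (proj2_sig f))
         : hom (LinAlg_prod L L) M |};
    intros; apply LinAlg_hom_eq.
  - apply diff_eps.
  - apply diff_add.
  - apply diff_zero.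
  - apply diff_of_eps.
  - apply diff_add_r.
  - apply diff_zero_r.
  - apply diff_id.
  - apply diff_proj0.
  - apply diff_proj1.
  - apply diff_pairing.
  - apply diff_comp.
  - apply diff_diff_linear.
  - apply diff_diff_sym.
Defined.

End LinearAlgebras.

Theorem proposition6p8 (X : Category) (H : CartesianDifference X) :
  exists HL : CartesianDifference (LinAlg X),
    (forall L1 L2 : LinAlg X,
       algebra_data (proj1_sig (L1 × L2)) =
       prod_algebra_data (proj1_sig L1) (proj1_sig L2)) /\
    algebra_data (proj1_sig (⊤ : LinAlg X)) = terminal_algebra_data X /\
    strictly_preserves (LinAlg_forget X).
Proof.
  exists (LinAlg_difference (X := X)). split; [reflexivity | split; [reflexivity |]].
  (* The underlying objects and maps are definitionally those of [X], so the casts are along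
     [eq_refl] and every preservation equation holds by computation. *)
  now exists (fun _ _ => eq_refl) eq_refl.
Qed.
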